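(* Let $\tau:[0,1]\to[0,\tfrac23]$ be the Takagi function and, for $0\le y\le \frac23$, let $L(y)$ be its level set at level $y$. Then: (1) For a full Lebesgue measure set of ordinate points $y\in[0,\frac23]$, the level set $L(y)$ is a finite set. (2) For a random level set $L(y)$ with level $y$ drawn uniformly from $[0,\frac23]$, the expected number of elements in $L(y)$ is infinite; that is, $\frac32\int_0^{2/3}|L(y)|\,dy=+\infty$, where $|L(y)|$ denotes the number of elements of $L(y)$.
   Context: The Takagi function is $\tau(x)=\sum_{n=0}^\infty \frac{\ll 2^n x\gg}{2^n}$ for $x\in[0,1]$, where $\ll t\gg$ denotes the distance from $t$ to the nearest integer. It is continuous with $0\le\tau(x)\le\frac23$. For $0\le y\le\frac23$ the (global) level set is $L(y)=\{x:\ \tau(x)=y,\ 0\le x\le 1\}$. Convention: $x$ specifies a particular binary expansion $0.b_1b_2b_3\ldots$, so each dyadic rational value $x=\frac{m}{2^n}$ having two such binary expansions appears twice in a level set, labeled by each of its two possible binary expansions. *)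

(* Defs.v *)
From mathcomp Require Export all_boot all_order all_algebra.
From mathcomp Require Export all_classical all_reals all_analysis.
From mathcomp Require Export measurable_realfun.

Set Implicit Arguments.
Unset Strict Implicit.
Unset Printing Implicit Defensive.

Export Order.TTheory GRing.Theory Num.Theory.
Export numFieldNormedType.Exports.

Local Open Scope classical_set_scope.
Local Open Scope ring_scope.

Section takagi.
Context {R : realType}.

Definition dist_int (t : R) : R := inf [set `|t - m%:~R| | m in [set: int]].

Definition takagi (x : R) : R :=
  limn (series (fun n => dist_int (2 ^+ n * x) / 2 ^+ n : R)).

(* A binary expansion [0.b_1 b_2 b_3 ...] is encoded by the sequence of its
   digits, indexed from 0: [b k] is the digit of weight [2 ^- k.+1]. *)
Definition binary_value (b : nat -> bool) : R :=
  limn (series (fun k => (b k)%:R / 2 ^+ k.+1 : R)).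

(* The elements of a level set are binary expansions, so a point with two
   binary expansions counts twice.  Every [binary_value b] lies in [0, 1], and
   every point of [0, 1] is of this form. *)
Definition takagi_level_set (y : R) : set (nat -> bool) :=
  [set b | takagi (binary_value b) = y].

(* The number of elements of [takagi_level_set y], [+oo] if it is infinite. *)
Definition takagi_level_card (y : R) : \bar R :=
  counting (takagi_level_set y).

Lemma lt0_23 : 0 < 2 / 3 :> R.
Proof. by rewrite divr_gt0 ?ltr0n. Qed.

End takagi.

(* Main.v *)
(* Write f_d(b) = d x_b + tau(x_b), where x_b is the point with binary digits b.
   The functional equation of tau gives
     f_d(0t) = f_{d+1}(t) / 2,   f_d(1t) = (d + 1 + f_{d-1}(t)) / 2,
   so that prepending digits moves d as a simple random walk (d is the number of
   0 digits minus the number of 1 digits read so far) while halving lengths.  All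
   estimates are recursions along this walk.

   Counting: the number of length-n prefixes of elements of L(y) increases to
   |L(y)| and is measurable in y, since the range of f_d is a compact interval.
   That range has length at least |d|, so the integral of the n-th count is at
   least E|S_n| for the simple random walk S, which tends to infinity; second and
   fourth moments suffice to see this.

   Finiteness: an expansion in L(y) returns the walk to 0 some number of times.
   Since tau(1 - x) = tau(x), the first excursion may be assumed to start with
   the digit 0, which has probability 1/2; so the set of y having an expansion
   with at least k returns has measure at most 2^-k.  On the other hand the
   integral over y of the number of expansions in L(y) with fewer than j returns
   is finite: up to constants, |d| + j is superharmonic for the walk started at d
   and killed at its j-th return. *)
From HB Require Import structures.
Require Import Defs.
From mathcomp Require Import finmap ring lra zify.

Set Implicit Arguments.
Unset Strict Implicit.
Unset Printing Implicit Defensive.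

Local Open Scope classical_set_scope.
Local Open Scope ring_scope.

(** * The Takagi function: functional equation, symmetry and continuity *)

Section takagi_function.
Context {R : realType}.
Implicit Types (s t x y : R) (b : nat -> bool) (d : int).

Lemma dist_int_has_inf t : has_inf [set `|t - m%:~R| | m in [set: int]].
Proof.
split; first by exists `|t - 0%:~R|, 0.
by exists 0 => _ [m _ <-].
Qed.

Lemma dist_int_le t (m : int) : dist_int t <= `|t - m%:~R|.
Proof. by apply: ge_inf; [case: (dist_int_has_inf t)|exists m]. Qed.

Lemma le_dist_int t x : (forall m : int, x <= `|t - m%:~R|) -> x <= dist_int t.
Proof.
by move=> H; apply: lb_le_inf; [case: (dist_int_has_inf t)|move=> _ [m _ <-]].
Qed.

Lemma dist_int_ge0 t : 0 <= dist_int t.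
Proof. exact: le_dist_int. Qed.

Lemma dist_int_le1 t : dist_int t <= 1.
Proof.
apply: (le_trans (dist_int_le t (Num.floor t))).
have := floor_le t; have := floorD1_gt t; rewrite intrD ler_norml; lra.
Qed.

Lemma dist_intN t : dist_int (- t) = dist_int t.
Proof.
suff H s : dist_int s <= dist_int (- s).
  by apply/eqP; rewrite eq_le H andbT (le_trans (H _))?opprK.
apply: le_dist_int => m; rewrite -normrN opprD !opprK.
by apply: (le_trans (dist_int_le _ (- m))); rewrite intrN opprK.
Qed.

Lemma dist_intD t (m : int) : dist_int (t + m%:~R) = dist_int t.
Proof.
suff H s (k : int) : dist_int s <= dist_int (s + k%:~R).
  apply/eqP; rewrite eq_le H andbT.
  by apply: (le_trans (H _ (- m))); rewrite intrN addrK.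
apply: le_dist_int => i; apply: (le_trans (dist_int_le _ (i - k))).
by rewrite intrB opprB addrA.
Qed.

Lemma dist_int_id t : 0 <= t <= 1 / 2 -> dist_int t = t.
Proof.
move=> t01; apply/eqP; rewrite eq_le; apply/andP; split.
  by apply: (le_trans (dist_int_le t 0)); rewrite subr0 ger0_norm//; lra.
apply: le_dist_int => m; rewrite ler_normr.
have [m0|m0] := lerP m 0.
  have : m%:~R <= 0 :> R by rewrite lerz0.
  by move=> ?; apply/orP; left; lra.
have : 1 <= m%:~R :> R by rewrite (ler_int R 1 m); lia.
by move=> ?; apply/orP; right; lra.
Qed.

Lemma dist_int_lipschitz s t : `|dist_int s - dist_int t| <= `|s - t|.
Proof.
have H (u v : R) : dist_int u - dist_int v <= `|u - v|.
  suff : dist_int u - `|u - v| <= dist_int v by lra.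
  apply: le_dist_int => m.
  rewrite lerBlDl; apply: (le_trans (dist_int_le _ m)).
  by rewrite (le_trans _ (ler_normD _ _))// addrA subrK.
by rewrite ler_norml H andbT lerNl opprB distrC H.
Qed.

Lemma cvg_geometric_half : (2^-1 ^+ n : R) @[n --> \oo] --> (0 : R).
Proof. by apply: cvg_expr; rewrite ger0_norm; lra. Qed.

Lemma is_cvg_series_half (u : R^nat) (M : R) :
  (forall n, 0 <= u n <= M / 2 ^+ n) -> cvgn (series u).
Proof.
move=> H; apply: (@series_le_cvg _ _ (geometric M 2^-1)).
- by move=> n; case/andP: (H n).
- by move=> n /=; rewrite exprVn; have /andP[a b] := H n; apply: le_trans b.
- by move=> n /=; rewrite exprVn; case/andP: (H n).
- by apply: is_cvg_geometric_series; rewrite ger0_norm; lra.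
Qed.

Lemma is_cvg_takagi x :
  cvgn (series (fun n => dist_int (2 ^+ n * x) / 2 ^+ n : R)).
Proof.
apply: (@is_cvg_series_half _ 1) => n; have p : 0 < (2 ^+ n)^-1 :> R.
  by rewrite invr_gt0 exprn_gt0.
by rewrite ler_pM2r// dist_int_le1 mulr_ge0 ?dist_int_ge0 1?ltW.
Qed.

Lemma series_recl (u : R^nat) n :
  series u n.+1 = u 0%N + series (fun k => u k.+1) n.
Proof. by rewrite /series /= big_nat_recl. Qed.

Lemma lim_series_recl (u v : R^nat) (k : R) :
  (forall n, u n.+1 = k * v n) -> cvgn (series v) ->
  limn (series u) = u 0%N + k * limn (series v).
Proof.
move=> uv cv; apply/cvg_lim => //; rewrite -cvg_shiftS.
rewrite (_ : (fun n => _) = (fun n => u 0%N + k * series v n)); last first.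
  apply/funext => n; rewrite series_recl; congr +%R.
  by rewrite /series /= mulr_sumr; apply: eq_bigr.
by apply: cvgD; [exact: cvg_cst|apply: cvgMr; exact: cv].
Qed.

Lemma takagi_rec x : takagi x = dist_int x + 2^-1 * takagi (2 * x).
Proof.
rewrite /takagi (@lim_series_recl _
  (fun n => dist_int (2 ^+ n * (2 * x)) / 2 ^+ n) 2^-1).
- by rewrite expr0 mul1r divr1.
- by move=> n; rewrite (mulrA (2 ^+ n)) -exprSr [in _^-1]exprS invfM; ring.
- exact: is_cvg_takagi.
Qed.

Lemma takagiN x : takagi (- x) = takagi x.
Proof.
rewrite /takagi; congr (limn (series _)); apply/funext => n.
by rewrite mulrN dist_intN.
Qed.

Lemma takagiD1 x : takagi (x + 1) = takagi x.
Proof.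
rewrite /takagi; congr (limn (series _)); apply/funext => n.
rewrite mulrDr mulr1 -natrX -[X in _ + X](_ : (2 ^ n)%:Z%:~R = _).
  by rewrite dist_intD.
by rewrite pmulrn.
Qed.

Lemma takagi_onem x : takagi (1 - x) = takagi x.
Proof. by rewrite addrC takagiD1 takagiN. Qed.

Lemma takagi_ge0 x : 0 <= takagi x.
Proof.
apply: limr_ge; first exact: is_cvg_takagi.
apply: nearW => n; apply: sumr_ge0 => i _.
by rewrite mulr_ge0 ?dist_int_ge0// invr_ge0 exprn_ge0.
Qed.

(** Crude bound from [dist_int <= 1], enough to start the inductions for the modulus of continuity
    and for the sharper bound 2/3. *)
Lemma takagi_le2 x : takagi x <= 2.
Proof.
apply: limr_le; first exact: is_cvg_takagi.
apply: nearW => n; suff : series (fun n => dist_int (2 ^+ n * x) / 2 ^+ n) n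
    <= 2 - 2 / 2 ^+ n :> R.
  by move=> H; apply: (le_trans H); rewrite gerBl divr_ge0 ?exprn_ge0.
elim: n => [|n IH]; first by rewrite /series /= big_geq// expr0; lra.
rewrite seriesSr (le_trans (lerD IH (_ : _ <= 1 / 2 ^+ n)))//.
  by rewrite ler_pM2r ?dist_int_le1// invr_gt0 exprn_gt0.
by rewrite exprS invfM; set p := (2 ^+ n)^-1; lra.
Qed.

(** Each of the first [n] terms of the series is 1-Lipschitz, since doubling the argument
    compensates the halving; the tail lies between 0 and [2 / 2 ^+ n]. *)
Lemma takagi_modulus n x y :
  `|takagi x - takagi y| <= n%:R * `|x - y| + 2 / 2 ^+ n.
Proof.
elim: n x y => [|n IH] x y.
  rewrite mul0r add0r expr0 ler_norml.
  have := takagi_ge0 x; have := takagi_ge0 y.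
  by have := takagi_le2 x; have := takagi_le2 y; lra.
rewrite (takagi_rec x) (takagi_rec y).
have -> : dist_int x + 2^-1 * takagi (2 * x)
    - (dist_int y + 2^-1 * takagi (2 * y)) =
  dist_int x - dist_int y + 2^-1 * (takagi (2 * x) - takagi (2 * y)) by ring.
apply: (le_trans (ler_normD _ _)).
rewrite normrM [ `|2^-1|]ger0_norm ?invr_ge0//.
have := IH (2 * x) (2 * y); rewrite -mulrBr normrM [ `|2|]ger0_norm//.
have := dist_int_lipschitz x y.
rewrite exprS invfM -[n.+1%:R]natr1; set p := (2 ^+ n)^-1.
set A := `|x - y|; set B := `|takagi _ - takagi _|; set C := `|_ - _|.
set N := n%:R.
move=> h1 h2; have : 2^-1 * B <= 2^-1 * (N * (2 * A) + 2 * p) by lra.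
by rewrite (_ : 2^-1 * (_ + _) = N * A + p)//; [lra|field].
Qed.

Lemma continuous_takagi : continuous (@takagi R).
Proof.
move=> x; apply/cvgrPdist_lt => e e0.
have e2 : 0 < e / 4 by lra.
have /cvgr0Pnorm_lt/(_ _ e2)[n _ Hn] := cvg_geometric_half.
have {}Hn := Hn n (leqnn n); rewrite /= ger0_norm ?exprn_ge0 ?invr_ge0// in Hn.
have n0 : 0 < n.+1%:R :> R by [].
(* The tail already costs less than [e / 2]; the Lipschitz part gets the other half. Dividing by
   [n.+1] covers the case [n = 0]. *)
have d0 : 0 < e / 2 / n.+1%:R by rewrite divr_gt0//; lra.
near=> y; apply: (le_lt_trans (takagi_modulus n x y)).
have H : `|x - y| < e / 2 / n.+1%:R.
  by near: y; exact: (@cvgr_dist_lt _ _ _ _ _ id x).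
rewrite ltr_pdivlMr// in H; rewrite exprVn in Hn.
have : n%:R * `|x - y| <= `|x - y| * n.+1%:R.
  by rewrite mulrC ler_wpM2l// ler_nat.
lra.
Unshelve. all: by end_near. Qed.

(** * Binary expansions *)

Lemma is_cvg_binary b : cvgn (series (fun k => (b k)%:R / 2 ^+ k.+1 : R)).
Proof.
apply: (@is_cvg_series_half _ (1 / 2)) => n.
have p : 0 < (2 ^+ n)^-1 :> R by rewrite invr_gt0 exprn_gt0.
by rewrite exprS invfM; case: (b n) => /=; lra.
Qed.

Definition scons (c : bool) b : nat -> bool :=
  fun k => if k is k'.+1 then b k' else c.

Definition stail b : nat -> bool := fun k => b k.+1.

Lemma scons_stail b : scons (b 0%N) (stail b) = b.
Proof. by apply/funext => -[]. Qed.

Lemma binary_value_scons c b :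
  binary_value (scons c b) = (c%:R + binary_value b) / 2 :> R.
Proof.
rewrite /binary_value (@lim_series_recl _ (fun k => (b k)%:R / 2 ^+ k.+1) 2^-1).
- by rewrite expr1; ring.
- by move=> n /=; rewrite [in LHS]exprS invfM; ring.
- exact: is_cvg_binary.
Qed.

Lemma binary_value_ge0 b : 0 <= binary_value b :> R.
Proof.
apply: limr_ge; first exact: is_cvg_binary.
apply: nearW => n; apply: sumr_ge0 => i _.
by rewrite mulr_ge0 ?invr_ge0 ?exprn_ge0.
Qed.

Lemma series_binary_neg b n :
  series (fun k => (~~ b k)%:R / 2 ^+ k.+1 : R) n =
  1 - 2^-1 ^+ n - series (fun k => (b k)%:R / 2 ^+ k.+1 : R) n.
Proof.
elim: n => [|n IH]; first by rewrite /series /= !big_geq// expr0; ring.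
rewrite !seriesSr IH !exprS invfM -exprVn.
by set p := _ ^+ n; case: (b n) => /=; field.
Qed.

Lemma binary_value_neg b :
  binary_value (fun k => ~~ b k) = 1 - binary_value b :> R.
Proof.
apply/cvg_lim => //; rewrite (funext (series_binary_neg b)).
rewrite -[X in X - _]subr0; apply: cvgB; last exact: is_cvg_binary.
by apply: cvgB; [exact: cvg_cst|exact: cvg_geometric_half].
Qed.

Lemma binary_value_le1 b : binary_value b <= 1 :> R.
Proof.
have := binary_value_ge0 (fun k => ~~ b k).
by rewrite binary_value_neg subr_ge0.
Qed.

(* Orbit of [x] under the doubling map; its comparisons with 1/2 are the binary
   digits of [x]. *)
Fixpoint bin_orbit x n : R :=
  if n is m.+1 then
    let u := bin_orbit x m in if 1 / 2 <= u then 2 * u - 1 else 2 * u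
  else x.

Lemma bin_orbit01 x n : 0 <= x <= 1 -> 0 <= bin_orbit x n <= 1.
Proof.
by move=> x01; elim: n => //= n IH; case: ifPn; rewrite -?ltNge; lra.
Qed.

Lemma binary_value_surj x : 0 <= x <= 1 -> exists b, binary_value b = x.
Proof.
move=> x01; exists (fun k => 1 / 2 <= bin_orbit x k).
apply/cvg_lim => //.
(* After [n] digits the error is the orbit point scaled by [2 ^- n], and the orbit stays in
   [0, 1]. *)
have H n : series (fun k => (1 / 2 <= bin_orbit x k)%R%:R / 2 ^+ k.+1 : R) n =
    x - bin_orbit x n * 2^-1 ^+ n.
  elim: n => [|n IH]; first by rewrite /series /= big_geq// expr0; ring.
  rewrite seriesSr IH exprS invfM exprS -exprVn /=.
  by set p := _ ^+ n; case: ifPn => _ /=; field.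
rewrite (funext H) -[X in _ --> X]subr0.
apply: cvgB; first exact: cvg_cst.
apply: (@squeeze_cvgr _ _ _ _ (fun=> 0) (fun n => 2^-1 ^+ n)).
- apply: nearW => n; have /andP[u0 u1] := bin_orbit01 n x01.
  by rewrite mulr_ge0 ?exprn_ge0 ?invr_ge0//= ler_piMl ?exprn_ge0 ?invr_ge0.
- exact: cvg_cst.
- exact: cvg_geometric_half.
Qed.

(** * The tilted functions f_d: recursion on digits, level sets and ranges *)

(* [tilted d (binary_value b)] is the f_d(b) of the header. *)
Definition tilted d x : R := d%:~R * x + takagi x.

Lemma tilted_scons0 d b : tilted d (binary_value (scons false b)) =
  tilted (d + 1) (binary_value b) / 2.
Proof.
rewrite /tilted binary_value_scons takagi_rec mulrA (mulrC 2) -mulrA.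
set x := binary_value b; have x0 : 0 <= x := binary_value_ge0 b.
have x1 : x <= 1 := binary_value_le1 b.
rewrite dist_int_id; last by rewrite /=; lra.
by rewrite divff// mulr1 add0r intrD; field.
Qed.

Lemma tilted_scons1 d b : tilted d (binary_value (scons true b)) =
  (d%:~R + 1 + tilted (d - 1) (binary_value b)) / 2.
Proof.
rewrite /tilted binary_value_scons takagi_rec.
set x := binary_value b; have x0 : 0 <= x := binary_value_ge0 b.
have x1 : x <= 1 := binary_value_le1 b.
rewrite [2 * _]mulrCA divff// mulr1 [1 + x]addrC takagiD1.
(* The point (x + 1) / 2 is reflected to (1 - x) / 2, which lies in [0, 1/2]. *)
rewrite -dist_intN -(dist_intD _ 1) dist_int_id; last by rewrite /=; lra.
by rewrite intrB; field.
Qed.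

(** This symmetry allows the first digit to be taken equal to 0, both in the bound 2/3 and in the
    estimate on returns. *)
Lemma tilted0_neg b : tilted 0 (binary_value (fun k => ~~ b k)) =
  tilted 0 (binary_value b).
Proof. by rewrite /tilted !mul0r !add0r binary_value_neg takagi_onem. Qed.

(* Two digits after an initial 0 give tau(x) <= 1/2 + tau(x') / 4, whose
   fixed point is 2/3. *)
Lemma takagi_binary_le n b :
  takagi (binary_value b) <= 2 / 3 + 4 / 3 / 4 ^+ n :> R.
Proof.
elim: n b => [|n IH] b.
  by have := takagi_le2 (binary_value b); rewrite expr0; lra.
have E x : takagi x = tilted 0 x by rewrite /tilted mul0r add0r.
wlog b0 : b / b 0%N = false.
  move=> H; case Eb: (b 0%N); last exact: H.
  by rewrite E -tilted0_neg -E; apply: H; rewrite Eb.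
rewrite E -(scons_stail b) b0 tilted_scons0 -(scons_stail (stail b)).
have x1 := binary_value_le1 (stail (stail b)).
have := IH (stail (stail b)); rewrite exprS invfM.
case: (stail b 0%N).
  rewrite tilted_scons1 /tilted; move: (takagi _) => T.
  by set p := (4 ^+ n)^-1; lra.
rewrite tilted_scons0 /tilted; move: (takagi _) => T.
by set p := (4 ^+ n)^-1; lra.
Qed.

Lemma takagi_binary_le23 b : takagi (binary_value b) <= 2 / 3 :> R.
Proof.
apply/ler_addgt0Pl => e e0.
have e1 : 0 < e * (3 / 4) by lra.
have /cvgr0Pnorm_lt/(_ _ e1)[n _ Hn] : (4^-1 ^+ n : R) @[n --> \oo] --> (0 : R).
  by apply: cvg_expr; rewrite ger0_norm; lra.
have := Hn n (leqnn n); rewrite /= ger0_norm ?exprn_ge0 ?invr_ge0// => H.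
have := takagi_binary_le n b; rewrite -exprVn; lra.
Qed.

Lemma continuous_tilted d : continuous (tilted d).
Proof.
move=> x; apply: cvgD; last exact: continuous_takagi.
by apply: cvgMr; exact: cvg_id.
Qed.

Definition tilted_level d y : set (nat -> bool) :=
  [set b | tilted d (binary_value b) = y].

Lemma tilted_level0 : tilted_level 0 = @takagi_level_set R.
Proof.
apply/funext => y; rewrite /tilted_level /takagi_level_set.
by under eq_fun do rewrite /tilted mul0r add0r.
Qed.

Lemma scons0_tilted_level d y b :
  tilted_level d y (scons false b) = tilted_level (d + 1) (2 * y) b.
Proof.
by rewrite /tilted_level/= tilted_scons0; apply/propext; split; lra.
Qed.

Lemma scons1_tilted_level d y b :
  tilted_level d y (scons true b) =
  tilted_level (d - 1) (2 * y - (d%:~R + 1)) b.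
Proof.
by rewrite /tilted_level/= tilted_scons1; apply/propext; split; lra.
Qed.

Definition tilted_range d : set R := [set y | tilted_level d y !=set0].

Lemma tilted_rangeE d : tilted_range d = tilted d @` `[0, 1].
Proof.
apply/seteqP; split => y.
  move=> [b <-]; exists (binary_value b) => //=.
  by rewrite in_itv/= binary_value_ge0 binary_value_le1.
move=> [x]; rewrite /= in_itv/= => /binary_value_surj[b <-] <-.
by exists b.
Qed.

Lemma measurable_tilted_range d :
  measurable (tilted_range d : set (measurableTypeR R)).
Proof.
rewrite tilted_rangeE; apply: compact_measurable.
apply: continuous_compact; last exact: segment_compact.
by apply: continuous_subspaceT; exact: continuous_tilted.
Qed.

Lemma takagi0 : takagi 0 = 0 :> R.
Proof.
by have := takagi_rec 0; rewrite mulr0 dist_int_id; [lra|rewrite /=; lra].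
Qed.

(** The values at the endpoints 0 and 1 are 0 and [d]; the intermediate value theorem fills the
    gap. *)
Lemma subset_tilted_range d :
  `[Num.min 0 d%:~R, Num.max 0 d%:~R]%classic `<=` tilted_range d.
Proof.
have t0 : tilted d 0 = 0 by rewrite /tilted mulr0 add0r takagi0.
have t1 : tilted d 1 = d%:~R.
  by rewrite /tilted mulr1 -(add0r 1) takagiD1 takagi0 addr0.
move=> y; rewrite /= in_itv/= tilted_rangeE => yd.
have [||x x01 xy] := @IVT R (tilted d) 0 1 y ler01.
- by apply: continuous_subspaceT; exact: continuous_tilted.
- by rewrite t0 t1.
- by exists x.
Qed.

Lemma tilted_range_subset d :
  tilted_range d `<=` `[Num.min 0 d%:~R, Num.max 0 d%:~R + 1]%classic.
Proof.
move=> y [b <-]; rewrite /= in_itv/= /tilted.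
have := takagi_binary_le23 b; have := takagi_ge0 (binary_value b).
have := binary_value_ge0 b; have := binary_value_le1 b.
set x := binary_value b => x1 x0 T0 T1.
have [dl|dl] := leP 0 (d%:~R : R); nra.
Qed.

End takagi_function.

(** * Cardinality of a set of digit sequences as a limit of prefix counts *)

Section prefix_counting.
Implicit Types (b : nat -> bool) (S : set (nat -> bool)).

(* The number of words of length [n] that are prefixes of an element of [S]. *)
Fixpoint prefixes n S : nat :=
  if n is m.+1 then
    (prefixes m [set b | S (scons false b)] +
     prefixes m [set b | S (scons true b)])%N
  else `[< S !=set0 >].

Lemma prefixes_set0 n : prefixes n set0 = 0%N.
Proof.
elim: n => [|n IH] /=; first by rewrite asboolF// => -[].
by rewrite (_ : [set _ | _] = set0) ?IH.
Qed.

Lemma prefixes_subset n S S' : S `<=` S' -> (prefixes n S <= prefixes n S')%N.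
Proof.
elim: n S S' => [|n IH] S S' SS' /=.
  case: asboolP => // -[b /SS' Sb].
  by rewrite asboolT//; exists b.
by apply: leq_add; apply: IH => b; apply: SS'.
Qed.

Lemma prefixes_leS n S : (prefixes n S <= prefixes n.+1 S)%N.
Proof.
elim: n S => [|n IH] S; last exact: leq_add.
rewrite /=; case: asboolP => // -[b]; rewrite -(scons_stail b).
case: (b 0%N) => Sb.
  by rewrite addnC asboolT//; exists (stail b).
by rewrite asboolT//; exists (stail b).
Qed.

Lemma prefixes_nondecreasing S : {homo prefixes^~ S : m n / (m <= n)%N}.
Proof.
by apply: homo_leq => // [|n]; [exact: leq_trans|exact: prefixes_leS].
Qed.

Lemma scons_inj c : injective (scons c).
Proof. by move=> a b /(congr1 stail). Qed.

(** Choosing one element of [S] above each prefix gives the upper bound of the prefix count by the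
    cardinality. *)
Lemma prefixes_witness n S : exists s : seq (nat -> bool),
  [/\ uniq s, size s = prefixes n S & {in s, forall b, S b}].
Proof.
elim: n S => [|n IH] S /=.
  case: asboolP => [[b Sb]|_]; last by exists [::].
  by exists [:: b]; split=> // a; rewrite inE => /eqP ->.
have [s0 [u0 <- H0]] := IH [set b | S (scons false b)].
have [s1 [u1 <- H1]] := IH [set b | S (scons true b)].
exists (map (scons false) s0 ++ map (scons true) s1); split.
- rewrite cat_uniq !(map_inj_uniq (@scons_inj _)) u0 u1 andbT /=.
  apply/hasPn => _ /mapP[b _ ->]; apply/mapP => -[a _].
  by move/(congr1 (fun f => f 0%N)).
- by rewrite size_cat !size_map.
- by move=> b; rewrite mem_cat => /orP[] /mapP[a]; [move/H0|move/H1] => ? ->.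
Qed.

(** Two distinct sequences differ at some index, and finitely many pairs admit a common bound on
    these indices. *)
Lemma exists_separating_prefix (ps : seq ((nat -> bool) * (nat -> bool))) :
  exists n,
    {in ps, forall p, (forall k, (k < n)%N -> p.1 k = p.2 k) -> p.1 = p.2}.
Proof.
elim: ps => [|[a b] ps [n IH]]; first by exists 0%N.
have [m Hm] : exists m, (forall k, (k < m)%N -> a k = b k) -> a = b.
  have [->|ab] := eqVneq a b; first by exists 0%N.
  apply: contrapT => H; move/eqP: ab; apply; apply/funext => k.
  apply: contrapT => abk; apply: H; exists k.+1 => /(_ k (leqnn _)).
  by move/abk.
exists (maxn m n) => p; rewrite inE => /orP[/eqP ->/= H|pps H].
  by apply: Hm => k km; apply: H; rewrite leq_max km.
by apply: IH => // k kn; apply: H; rewrite leq_max kn orbT.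
Qed.

(** The list is split by first digit. Within each half the heads agree, so the tails are separated
    by one digit fewer. *)
Lemma size_le_prefixes n S (s : seq (nat -> bool)) :
  uniq s -> {in s, forall b, S b} ->
  {in s &, forall a b, (forall k, (k < n)%N -> a k = b k) -> a = b} ->
  (size s <= prefixes n S)%N.
Proof.
elim: n S s => [|n IH] S s us sS sep.
  case: s us sS sep => // a [|b s] us sS sep.
    by rewrite /= asboolT//; exists a; apply: sS; rewrite inE.
  have ab : a = b by apply: sep; rewrite ?inE ?eqxx ?orbT.
  by move: us; rewrite ab /= inE eqxx.
rewrite -(count_predC (fun b => ~~ b 0%N)) -!size_filter.
have H c (p : pred (nat -> bool)) : (forall b, p b -> b 0%N = c) ->
    (size (seq.filter p s) <= prefixes n [set b | S (scons c b)])%N.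
  move=> pc; rewrite -(size_map stail); apply: IH.
  - rewrite map_inj_in_uniq ?filter_uniq// => a b.
    rewrite !mem_filter => /andP[pa _] /andP[pb _] ab.
    by rewrite -(scons_stail a) -(scons_stail b) ab (pc _ pa) (pc _ pb).
  - move=> _ /mapP[b + ->]; rewrite mem_filter => /andP[pb bs] /=.
    by rewrite -(pc _ pb) scons_stail; exact: sS.
  - move=> _ _ /mapP[a + ->] /mapP[b + ->].
    rewrite !mem_filter => /andP[pa sa] /andP[pb sb] ab.
    congr stail; apply: sep => // -[_|k kn]; last exact: ab.
    by rewrite (pc _ pa) (pc _ pb).
apply: leq_add; apply: H => b /=; first exact: negbTE.
by rewrite negbK.
Qed.

Lemma exists_size_le_prefixes S (s : seq (nat -> bool)) :
  uniq s -> {in s, forall b, S b} -> exists n, (size s <= prefixes n S)%N.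
Proof.
move=> us sS.
have [n Hn] := exists_separating_prefix [seq (a, b) | a <- s, b <- s].
exists n; apply: size_le_prefixes => // a b sa sb.
by apply: (Hn (a, b)); apply/allpairsP; exists (a, b).
Qed.

Lemma prefixes_le_card n S : finite_set S ->
  (prefixes n S <= #|` fset_set S|)%N.
Proof.
move=> fS; have [s [us <- sS]] := prefixes_witness n S.
apply: uniq_leq_size => // b bs; by rewrite in_fset_set//; exact/mem_set/sS.
Qed.

Lemma finite_set_prefixes S M :
  (forall n, (prefixes n S <= M)%N) -> finite_set S.
Proof.
move=> H; apply: contrapT => /(infinite_set_fset M.+1)[F FS MF].
have [n] := @exists_size_le_prefixes S F (fset_uniq _) FS.
by move=> /(leq_trans MF); rewrite ltnNge H.
Qed.

(** Long enough prefixes separate any finite subset of [S]. If [S] is finite the count is thus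
    eventually equal to its cardinality; otherwise the count exceeds every bound. *)
Lemma cvg_prefixes (R : realType) S :
  ((prefixes n S)%:R%:E : \bar R) @[n --> \oo] --> (counting S : \bar R).
Proof.
rewrite /counting; case: asboolP => [fS|infS].
  have [n Hn] : exists n, (#|` fset_set S| <= prefixes n S)%N.
    apply: exists_size_le_prefixes; first exact: fset_uniq.
    by move=> b; rewrite in_fset_set// => /set_mem.
  apply: cvg_near_cst; exists n => // m /= nm; congr (_%:R%:E).
  apply/eqP; rewrite eqn_leq prefixes_le_card//=.
  by rewrite (leq_trans Hn)// prefixes_nondecreasing.
apply/cvgeyPge => M; have [F FS MF] := infinite_set_fset (Num.trunc M).+1 infS.
have [n Hn] := @exists_size_le_prefixes S F (fset_uniq _) FS.
exists n => // m /= nm; rewrite lee_fin.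
apply: (le_trans (ltW (truncnS_gt M))); rewrite ler_nat (leq_trans MF)//.
by rewrite (leq_trans Hn)// prefixes_nondecreasing.
Qed.

End prefix_counting.

(** * Integration along the walk and the infinite expectation *)

Section branching.
Context {R : realType}.
Local Notation mu := (@lebesgue_measure R).
Implicit Types (d : int) (c y : R) (h : R -> \bar R) (F : int -> R -> \bar R).

(** Undoes, on values of f_d, the prepending of a digit: [c = 0] for the digit 0 and [c = d + 1] for
    the digit 1. *)
Definition dbl c : measurableTypeR R -> measurableTypeR R := fun y => 2 * y - c.

Lemma measurable_dbl c : measurable_fun [set: measurableTypeR R] (dbl c).
Proof.
apply: continuous_measurable_fun => y.
apply: cvgB; last exact: cvg_cst.
by apply: cvgMr; exact: cvg_id.
Qed.

HB.instance Definition _ c :=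
  isMeasurableFun.Build _ _ _ _ (dbl c) (measurable_dbl c).

Lemma measurable_dbl_preimage c (E : set R) :
  measurable (E : set (measurableTypeR R)) ->
  measurable (dbl c @^-1` E : set (measurableTypeR R)).
Proof.
by move=> mE; rewrite -[X in measurable X]setTI; exact: measurable_dbl.
Qed.

(** Twice the pushforward of [mu] by [dbl c] agrees with [mu] on half-open intervals, so uniqueness
    of Lebesgue measure applies. *)
Lemma lebesgue_measure_dbl c (E : set R) :
  measurable (E : set (measurableTypeR R)) ->
  mu (dbl c @^-1` E) = (2^-1%:E * mu E)%E.
Proof.
move=> mE.
have [nu nuE] : exists nu : {measure set (measurableTypeR R) -> \bar R},
    forall A, nu A = mu (dbl c @^-1` A).
  unshelve eexists.
    by refine (pushforward mu (dbl c)); exact: measurable_dbl.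
  by [].
pose two : {nonneg R} := NngNum (ler0n R 2).
suff : mu E = mscale two nu E.
  by move=> ->; rewrite /mscale/= -nuE muleA -EFinM mulVf// mul1e.
apply: lebesgue_measure_unique => //= _ [[a b]] _ <-.
rewrite /mscale nuE/=.
have -> : dbl c @^-1` `]a, b] = `](a + c) / 2, (b + c) / 2]%classic.
  by apply/seteqP; split => y /=; rewrite !in_itv/= /dbl; lra.
rewrite !lebesgue_measure_itv/= !lte_fin ltr_pM2r// ltrD2r.
case: ifPn => _; last by rewrite mule0.
by rewrite -!EFinD -EFinM; congr (_%:E); field.
Qed.

Lemma ge0_integral_dbl c h :
  measurable_fun [set: R] h -> (forall y, 0 <= h y)%E ->
  (\int[mu]_y h (2 * y - c)%R = 2^-1%:E * \int[mu]_y h y)%E.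
Proof.
move=> mh h0.
rewrite -(@ge0_integral_mscale _ _ _ mu setT measurableT (2^-1%:nng) h)//.
have := ge0_integral_pushforward (measurable_dbl c) mu measurableT mh (in1W h0).
rewrite preimage_setT => <-; apply: eq_measure_integral => E mE _.
exact: lebesgue_measure_dbl.
Qed.

(** One step of the walk. The two terms are added, not averaged: the step probability 1/2 comes from
    the change of variable when integrating in [y]. *)
Definition branch F d y : \bar R :=
  (F (d + 1)%R (2 * y)%R + F (d - 1)%R (2 * y - (d%:~R + 1))%R)%E.

Lemma measurable_comp_dbl c h : measurable_fun [set: R] h ->
  measurable_fun [set: R] (fun y => h (2 * y - c)).
Proof. by move=> mh; exact: (measurableT_comp mh (measurable_dbl c)). Qed.

Lemma measurable_branch F d : (forall d, measurable_fun [set: R] (F d)) ->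
  measurable_fun [set: R] (branch F d).
Proof.
move=> mF; apply: emeasurable_funD; last exact: measurable_comp_dbl.
by under eq_fun do rewrite -[2 * _]subr0; exact: measurable_comp_dbl.
Qed.

Lemma integral_branch F d : (forall d, measurable_fun [set: R] (F d)) ->
  (forall d y, 0 <= F d y)%E ->
  (\int[mu]_y branch F d y =
   2^-1%:E * (\int[mu]_y F (d + 1)%R y + \int[mu]_y F (d - 1)%R y))%E.
Proof.
move=> mF F0.
have I0 d' : (0 <= \int[mu]_y F d' y)%E.
  by apply: integral_ge0 => y _; exact: F0.
rewrite ge0_integralD//; last 2 first.
- under eq_fun do rewrite -[2 * _]subr0; exact: measurable_comp_dbl.
- exact: measurable_comp_dbl.
rewrite ge0_integral_dbl//.
under eq_integral do rewrite -[2 * _]subr0.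
rewrite ge0_integral_dbl//.
by rewrite (ge0_muleDr _ (I0 _) (I0 _)).
Qed.

Definition level_prefixes n d y : \bar R :=
  (prefixes n (tilted_level d y))%:R%:E.

Lemma level_prefixes_ge0 n d y : (0 <= level_prefixes n d y)%E.
Proof. by rewrite lee_fin. Qed.

Lemma level_prefixes0 d :
  level_prefixes 0 d = fun y => (\1_(tilted_range d) y)%:E.
Proof.
apply/funext => y; rewrite /level_prefixes /= indicE; congr (_%:R%:E).
Qed.

Lemma level_prefixesS n d : level_prefixes n.+1 d = branch (level_prefixes n) d.
Proof.
apply/funext => y; rewrite /level_prefixes /branch /= natrD EFinD.
congr (_%:R%:E + _%:R%:E)%E; congr prefixes; apply/funext => b /=.
  exact: scons0_tilted_level.
exact: scons1_tilted_level.
Qed.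

Lemma measurable_level_prefixes n d :
  measurable_fun [set: R] (level_prefixes n d).
Proof.
elim: n d => [|n IH] d; last first.
  by rewrite level_prefixesS; exact: measurable_branch.
rewrite level_prefixes0; apply/measurable_EFinP/measurable_indic.
exact: measurable_tilted_range.
Qed.

Lemma lebesgue_measure_tilted_range_ge d :
  (`|d|%N%:R%:E <= mu (tilted_range d))%E.
Proof.
apply: (@le_trans _ _ (mu `[Num.min 0 d%:~R, Num.max 0 d%:~R])); last first.
  apply: le_measure; last exact: subset_tilted_range.
    by apply/mem_set.
  by apply/mem_set; exact: measurable_tilted_range.
rewrite lebesgue_measure_itv/= lte_fin.
have -> : (`|d|%N%:R : R) = `|d%:~R| by rewrite -intr_norm natr_absz.
have [d0|d0|<-] := ltrgtP 0 (d%:~R : R).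
- by rewrite d0 -EFinD subr0 gtr0_norm.
- by rewrite d0 -EFinD sub0r ltr0_norm.
- by rewrite ltxx normr0.
Qed.

Lemma lebesgue_measure_tilted_range_le d :
  (mu (tilted_range d) <= (`|d|%N%:R + 1)%:E)%E.
Proof.
apply: (@le_trans _ _ (mu `[Num.min 0 d%:~R, Num.max 0 d%:~R + 1])).
  apply: le_measure; last exact: tilted_range_subset.
    by apply/mem_set; exact: measurable_tilted_range.
  by apply/mem_set.
rewrite lebesgue_measure_itv/= lte_fin.
have -> : (`|d|%N%:R : R) = `|d%:~R| by rewrite -intr_norm natr_absz.
have [d0|d0] := lerP 0 (d%:~R : R).
  by rewrite ifT ?lee_fin ?ger0_norm//; lra.
by rewrite ifT ?lee_fin ?ltr0_norm//; lra.
Qed.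

(** A minorant of the absolute value by an even polynomial, whose expectation along the walk needs
    only second and fourth moments. With [u = x / c] it reduces to [u - u ^+ 3 <= 1]. *)
Lemma quartic_le_norm (c x : R) : 0 < c -> 0 <= x ->
  x ^+ 2 / c - x ^+ 4 / c ^+ 3 <= x.
Proof.
move=> c0 x0; pose u := x / c; have u0 : 0 <= u by rewrite divr_ge0// ltW.
have -> : x ^+ 2 / c - x ^+ 4 / c ^+ 3 = x * (u - u ^+ 3).
  by rewrite /u; field; rewrite gt_eqF.
apply: ler_piMr => //; have [u1|u1] := lerP u 1.
  by have := exprn_ge0 3 u0; lra.
have : u <= u ^+ 3 by apply: ler_eXnr; rewrite // ltW.
lra.
Qed.

(* The left-hand side is E[S^2 / c - S^4 / c^3], where S is the position after
   [n] steps of the simple random walk started at [d]. *)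
Lemma integral_level_prefixes_ge c n d : 0 < c ->
  (((d%:~R ^+ 2 + n%:R) / c -
    (d%:~R ^+ 4 + 6 * n%:R * d%:~R ^+ 2 + 3 * n%:R ^+ 2 - 2 * n%:R) / c ^+ 3)%:E
  <= \int[mu]_y level_prefixes n d y)%E.
Proof.
move=> c0; elim: n d => [|n IH] d.
  rewrite level_prefixes0 integral_indic//; last exact: measurable_tilted_range.
  rewrite setIT; apply: le_trans (lebesgue_measure_tilted_range_ge d).
  have -> : (`|d|%N%:R : R) = `|d%:~R| by rewrite -intr_norm natr_absz.
  rewrite lee_fin; apply: le_trans (quartic_le_norm c0 (normr_ge0 _)).
  rewrite -[in X in _ <= X / c - _]normrX -[in X in _ <= _ - X / _]normrX.
  rewrite !ger0_norm ?exprn_even_ge0// le_eqVlt; apply/orP; left.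
  by apply/eqP; ring.
rewrite level_prefixesS integral_branch//; last 2 first.
- exact: measurable_level_prefixes.
- exact: level_prefixes_ge0.
apply: le_trans (lee_wpmul2l _ (leeD (IH _) (IH _))); last by rewrite lee_fin.
rewrite -EFinD -EFinM lee_fin intrD intrB -natr1 le_eqVlt.
apply/orP; left; apply/eqP; field.
by rewrite gt_eqF.
Qed.

Lemma measurable_takagi_level_card :
  measurable_fun [set: R] (@takagi_level_card R).
Proof.
apply: (emeasurable_fun_cvg (level_prefixes^~ 0)).
  by move=> n; exact: measurable_level_prefixes.
move=> y _; rewrite /takagi_level_card -tilted_level0; exact: cvg_prefixes.
Qed.

Lemma takagi_level_card_ge0 y : (0 <= takagi_level_card y)%E.
Proof.
by rewrite /takagi_level_card /counting; case: ifP; rewrite ?lee_fin ?leey.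
Qed.

Lemma level_prefixes_le_card n y :
  (level_prefixes n 0 y <= takagi_level_card y)%E.
Proof.
rewrite /takagi_level_card -tilted_level0 -(cvg_lim _ (@cvg_prefixes R _))//.
apply: lime_ge; first by apply/cvg_ex; eexists; exact: cvg_prefixes.
by exists n => // m /= nm; rewrite lee_fin ler_nat prefixes_nondecreasing.
Qed.

Lemma integral_takagi_level_cardT : (\int[mu]_y takagi_level_card y = +oo)%E.
Proof.
apply/eqyP => M M0.
(* After m^2 steps the walk is at distance of order m. With c = 2m the lower bound equals m/2 - 3m/8
   + 1/(4m) = m/8 + 1/(4m), which exceeds M once m > 8M. *)
pose m := (Num.trunc (8 * M)).+1.
have m0 : 0 < m%:R :> R by rewrite ltr0n.
have c0 : 0 < 2 * m%:R :> R by rewrite mulr_gt0.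
apply: (@le_trans _ _ (\int[mu]_y level_prefixes (m ^ 2) 0 y)%E); last first.
  apply: ge0_le_integral => //.
  - by move=> y _; exact: level_prefixes_ge0.
  - exact: measurable_level_prefixes.
  - exact: (@measurable_takagi_level_card).
  - by move=> y _; exact: level_prefixes_le_card.
apply: le_trans (integral_level_prefixes_ge _ _ c0); rewrite lee_fin.
have : 8 * M < m%:R by exact: truncnS_gt.
rewrite natrX; set x : R := m%:R in m0 *.
have -> : (0%:~R ^+ 2 + x ^+ 2) / (2 * x) - (0%:~R ^+ 4 +
    6 * x ^+ 2 * 0%:~R ^+ 2 + 3 * (x ^+ 2) ^+ 2 - 2 * x ^+ 2) / (2 * x) ^+ 3
    = x / 8 + 1 / 4 / x.
  by field; rewrite gt_eqF.
have : 0 < 1 / 4 / x by rewrite divr_gt0.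
lra.
Qed.

Lemma takagi_level_card_out y : ~~ (0 <= y <= 2 / 3) ->
  takagi_level_card y = 0%E.
Proof.
move=> y01; rewrite /takagi_level_card (_ : takagi_level_set y = set0).
  by rewrite /counting asboolT// fset_set0.
rewrite -subset0 => b; rewrite /takagi_level_set/= => yb; move/negP: y01; apply.
by rewrite -yb takagi_ge0 takagi_binary_le23.
Qed.

Lemma integral_takagi_level_card :
  (\int[mu]_(y in `[0%R, (2 / 3)%R]) takagi_level_card y = +oo)%E.
Proof.
rewrite integral_mkcond -[RHS]integral_takagi_level_cardT.
apply: eq_integral => y _; rewrite patchE; case: ifPn => // yI.
rewrite takagi_level_card_out//; apply: contra yI => yI.
by apply/mem_set; rewrite /= in_itv.
Qed.

End branching.

(** * Returns of the walk to 0 and almost everywhere finiteness *)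

Section zeros_of_deficiency.
Context {R : realType}.
Local Notation mu := (@lebesgue_measure R).
Implicit Types (d : int) (y : R) (b : nat -> bool) (U : set R).

(* The number of times in 1..[n] at which the walk started at [d] and driven by
   the digits [b] is at 0. *)
Fixpoint zeros n d b : nat :=
  if n is m.+1 then
    let d' := if b 0%N then d - 1 else d + 1 in
    ((d' == 0%R) + zeros m d' (stail b))%N
  else 0%N.

Lemma zeros_neg n d b : zeros n (- d) (fun k => ~~ b k) = zeros n d b.
Proof.
elim: n d b => //= n IH d b.
have -> : (if ~~ b 0%N then - d - 1 else - d + 1) =
    - (if b 0%N then d - 1 else d + 1) by case: (b 0%N) => /=; ring.
by rewrite oppr_eq0 IH.
Qed.

(* Contains f_d(b) whenever the walk started at [d <> 0] reaches 0 within [m]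
   steps and [U] contains the value of f_0 at the remaining digits. *)
Fixpoint hit_zero U m d : set R :=
  if d == 0 then U else
  if m is m'.+1 then dbl 0 @^-1` (hit_zero U m' (d + 1)) `|`
    dbl (d%:~R + 1) @^-1` (hit_zero U m' (d - 1))
  else set0.

Lemma hit_zero0 U m : hit_zero U m 0 = U.
Proof. by case: m. Qed.

Lemma hit_zeroS U m d : d != 0 -> hit_zero U m.+1 d =
  dbl 0 @^-1` (hit_zero U m (d + 1)) `|`
  dbl (d%:~R + 1) @^-1` (hit_zero U m (d - 1)).
Proof. by move=> /negbTE d0; rewrite /= d0. Qed.

Lemma measurable_hit_zero U m d : measurable (U : set (measurableTypeR R)) ->
  measurable (hit_zero U m d : set (measurableTypeR R)).
Proof.
move=> mU; elim: m d => [|m IH] d /=; case: ifP => // _.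
by apply: measurableU; exact: measurable_dbl_preimage.
Qed.

(** By induction each of the two preimages has measure at most half of [mu U]. *)
Lemma lebesgue_measure_hit_zero U m d :
  measurable (U : set (measurableTypeR R)) -> (mu (hit_zero U m d) <= mu U)%E.
Proof.
move=> mU; have mH := measurable_hit_zero _ _ mU.
elim: m d => [|m IH] d /=; case: ifP => // _.
  by rewrite measure0 measure_ge0.
have H c d' : (mu (dbl c @^-1` hit_zero U m d') <= 2^-1%:E * mu U)%E.
  by rewrite lebesgue_measure_dbl//; apply: lee_wpmul2l.
apply: (le_trans (measureU2 _ _ _)); try exact: measurable_dbl_preimage.
apply: (le_trans (leeD (H _ _) (H _ _))).
rewrite -ge0_muleDl ?lee_fin ?invr_ge0// -EFinD (_ : 2^-1 + 2^-1 = 1) ?mul1e//.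
by field.
Qed.

Lemma hit_zero_leS U m d : hit_zero U m d `<=` hit_zero U m.+1 d.
Proof.
elim: m d => [|m IH] d; first by move=> y; rewrite /=; case: (d == 0).
have [->|d0] := eqVneq d 0; first by rewrite !hit_zero0.
rewrite !(hit_zeroS _ _ d0).
by apply: setUSS => y; exact: IH.
Qed.

(** Until its first visit to 0 the walk follows the recursion of [hit_zero]. That visit accounts for
    one of the at least [k + 1] zeros, and the remaining digits fall under the hypothesis on [U]. *)
Lemma zeros_hit_zero U k n d b :
  (forall m a, (k <= zeros m 0 a)%N -> U (tilted 0 (binary_value a))) ->
  d != 0 -> (k < zeros n d b)%N -> hit_zero U n d (tilted d (binary_value b)).
Proof.
move=> UP; elim: n d b => // n IH d b d0.
rewrite hit_zeroS// -(scons_stail b) /=; case: (b 0%N) => /= H; [right|left].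
- rewrite /= /dbl tilted_scons1.
  rewrite (_ : _ - _ = tilted (d - 1) (binary_value (stail b))); last by field.
  have [d1|d1] := eqVneq (d - 1) 0; last first.
    by apply: IH => //; move: H; rewrite (negbTE d1).
  by move: H; rewrite d1 hit_zero0 => H; exact: (UP n).
- rewrite /= /dbl tilted_scons0.
  rewrite (_ : _ - _ = tilted (d + 1) (binary_value (stail b))); last by field.
  have [d1|d1] := eqVneq (d + 1) 0; last first.
    by apply: IH => //; move: H; rewrite (negbTE d1).
  by move: H; rewrite d1 hit_zero0 => H; exact: (UP n).
Qed.

Lemma cover_many_zeros k : exists U : set R,
  [/\ measurable (U : set (measurableTypeR R)), (mu U <= (2^-1 ^+ k)%:E)%E &
    forall n b, (k <= zeros n 0 b)%N -> U (tilted 0 (binary_value b))].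
Proof.
elim: k => [|k [U [mU muU UP]]].
  exists (tilted_range 0); split; first exact: measurable_tilted_range.
  - by rewrite (le_trans (lebesgue_measure_tilted_range_le _))// add0r.
  - by move=> n b _; exists b.
(* After a first digit 0 the walk stands at 1. [V] collects the values of f_1 whose walk comes back
   to 0 at any time and then lands in [U]. *)
pose V := \bigcup_m hit_zero U m 1.
have mH m := @measurable_hit_zero U m 1 mU.
have mV : measurable (V : set (measurableTypeR R)) by exact: bigcup_measurable.
exists (dbl 0 @^-1` V); split.
- exact: measurable_dbl_preimage.
- rewrite lebesgue_measure_dbl// exprS EFinM; apply: lee_wpmul2l => //.
  have cV : mu (hit_zero U m 1) @[m --> \oo] --> mu V.
    apply: nondecreasing_cvg_mu => //.
    by apply/nondecreasing_seqP => m; apply/subsetPset; exact: hit_zero_leS.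
  rewrite -(cvg_lim _ cV)//; apply: lime_le.
    by apply/cvg_ex; eexists; exact: cV.
  by apply: nearW => m; apply: le_trans muU; exact: lebesgue_measure_hit_zero.
- move=> [//|n] b.
  (* Complementing all digits preserves both the value and the zeros. Hence one preimage under
     [dbl 0] covers both cases, which gains the factor 1/2. *)
  wlog b0 : b / b 0%N = false.
    move=> H; case Eb: (b 0%N); last exact: H.
    by rewrite -zeros_neg oppr0 -tilted0_neg; apply: H; rewrite Eb.
  rewrite /= b0 add0r oner_eq0 add0n -{2}(scons_stail b) b0 => H.
  exists n => //; rewrite /dbl /= tilted_scons0 add0r.
  rewrite (_ : _ - _ = tilted 1 (binary_value (stail b))); last by field.
  exact: (@zeros_hit_zero _ k).
Qed.

(** An exceptional [y] lies in the cover [U k] for every [k], and the measures of these covers tend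
    to 0. *)
Lemma ae_few_zeros : {ae mu, forall y, exists k, forall n b,
  tilted_level 0 y b -> (zeros n 0 b < k)%N}.
Proof.
have [U UP] := choice cover_many_zeros.
exists (\bigcap_k U k); split.
- by apply: bigcap_measurable => // k _; case: (UP k).
- apply/eqP; rewrite eq_le measure_ge0 andbT.
  apply/lee_addgt0Pr => e e0; rewrite add0e.
  have /cvgr0Pnorm_lt/(_ _ e0)[k _ Hk] := @cvg_geometric_half R.
  have := Hk k (leqnn k); rewrite /= ger0_norm ?exprn_ge0 ?invr_ge0// => ke.
  have [mU muU _] := UP k.
  apply: (@le_trans _ _ (mu (U k))); last first.
    by rewrite (le_trans muU)// lee_fin ltW.
  apply: le_measure; last exact: bigcap_inf.
    by apply/mem_set; apply: bigcap_measurable => // i _; case: (UP i).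
  by apply/mem_set.
- move=> y /= /forallNP yk k _; have [_ _ H] := UP k.
  have /existsNP[n /existsNP[b /not_implyP[yb /negP]]] := yk k.
  by rewrite -leqNgt -yb; exact: H.
Qed.

Definition few_zeros_level j d y : set (nat -> bool) :=
  tilted_level d y `&` [set b | forall n, (zeros n d b < j)%N].

(* A measurable substitute for [prefixes n (few_zeros_level j d y)]: the words of
   length [n] are only required to extend to an element of the level set. *)
Fixpoint few_zeros_bound n j d y : \bar R :=
  if j is 0%N then 0%E else
  if n is m.+1 then
    branch (fun d' => few_zeros_bound m (j - (d' == 0%R))%N d') d y
  else (\1_(tilted_range d) y)%:E.

Lemma few_zeros_bound0 n d y : few_zeros_bound n 0 d y = 0%E.
Proof. by case: n. Qed.

Lemma few_zeros_bound_ge0 n j d y : (0 <= few_zeros_bound n j d y)%E.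
Proof.
elim: n j d y => [|n IH] [|j] d y //=.
by rewrite /branch adde_ge0.
Qed.

Lemma measurable_few_zeros_bound n j d :
  measurable_fun [set: R] (few_zeros_bound n j d).
Proof.
elim: n j d => [|n IH] [|j] d /=; try exact: measurable_cst.
  by apply/measurable_EFinP/measurable_indic; exact: measurable_tilted_range.
exact: (@measurable_branch _
  (fun d' => few_zeros_bound n (j.+1 - (d' == 0%R))%N d')).
Qed.

(* Superharmonic for the walk whose budget [j] drops at each visit to 0. *)
Definition few_zeros_cost j d : nat :=
  if j is i.+1 then (2 * (`|d|%N + (d == 0%R) + i))%N else 0%N.

Lemma integral_few_zeros_bound n j d :
  (\int[mu]_y few_zeros_bound n j d y <= (few_zeros_cost j d)%:R%:E)%E.
Proof.
elim: n j d => [|n IH] [|j] d; try by rewrite /= integral0.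
  rewrite /= integral_indic//; last exact: measurable_tilted_range.
  rewrite setIT (le_trans (lebesgue_measure_tilted_range_le d))// lee_fin natr1.
  by rewrite ler_nat; lia.
rewrite [few_zeros_bound _ _ _]/=.
rewrite (integral_branch
  (F := fun d' => few_zeros_bound n (j.+1 - (d' == 0%R))%N d')); last 2 first.
- by move=> d'; exact: measurable_few_zeros_bound.
- by move=> d' y; exact: few_zeros_bound_ge0.
apply: (le_trans (lee_wpmul2l _ (leeD (IH _ _) (IH _ _)))).
  by rewrite lee_fin.
rewrite -EFinD -EFinM lee_fin ler_pdivrMl// -natrD -natrM ler_nat.
(* Arriving at 0 lowers the budget by one, which offsets the term [d' == 0], so the cost after a
   step has one form in all cases. What remains is |d + 1| + |d - 1| = 2 (|d| + [d = 0]). *)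
have H d' : few_zeros_cost (j.+1 - (d' == 0%R))%N d' = (2 * (`|d'| + j))%N.
  rewrite /few_zeros_cost; have [->|d0] := eqVneq d' 0; last first.
    by rewrite subn0; lia.
  by rewrite subn1 /=; case: j => //= j; lia.
by rewrite !H /few_zeros_cost; lia.
Qed.

Lemma prefixes_few_zeros n j d y :
  ((prefixes n (few_zeros_level j d y))%:R%:E <= few_zeros_bound n j d y)%E.
Proof.
elim: n j d y => [|n IH] j d y.
  case: j => [|j] /=; first by case: asboolP => // -[b [_ /(_ 0%N)]].
  case: asboolP => [[b [yb _]]|_]; last by rewrite lee_fin.
  by rewrite lee_fin indicE mem_set//; exists b.
case: j => [|j].
  rewrite few_zeros_bound0 (_ : few_zeros_level _ _ _ = set0).
    by rewrite prefixes_set0.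
  by rewrite -subset0 => b [_ /(_ 0%N)].
rewrite [few_zeros_bound _ _ _ _]/= /branch /= natrD EFinD.
apply: leeD; (apply: le_trans; last exact: IH); rewrite lee_fin ler_nat;
  apply: prefixes_subset => b [/= yb H]; split.
- by rewrite -scons0_tilted_level.
- by move=> m /=; have := H m.+1; rewrite /= ltn_subRL.
- by rewrite -scons1_tilted_level.
- by move=> m /=; have := H m.+1; rewrite /= ltn_subRL.
Qed.

(** By Fatou the lower limit of the bounds is integrable, hence finite almost everywhere. The prefix
    counts are nondecreasing in the length, so this lower limit dominates every one of them. *)
Lemma ae_finite_few_zeros_level j :
  {ae mu, forall y, finite_set (few_zeros_level j 0 y)}.
Proof.
pose f n := few_zeros_bound n j 0.
have mf n : measurable_fun setT (f n) by exact: measurable_few_zeros_bound.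
have f0 n y : (0 <= f n y)%E by exact: few_zeros_bound_ge0.
pose g y := limn_einf (f^~ y).
have einf_g y n : (einfs (f^~ y) n <= g y)%E.
  rewrite /g limn_einf_lim; apply: lime_ge; first exact: is_cvg_einfs.
  by exists n => // m /= nm; exact: nondecreasing_einfs.
have g0 y : (0 <= g y)%E.
  apply: le_trans (einf_g y 0%N).
  by apply: le_ereal_inf_tmp => _ [n _ <-].
have mg : measurable_fun setT g.
  apply: (emeasurable_fun_cvg (fun n y => einfs (f^~ y) n)).
    by move=> n; exact: measurable_fun_einfs.
  by move=> y _; rewrite /g limn_einf_lim; exact: is_cvg_einfs.
have intg : mu.-integrable setT g.
  apply/integrableP; split => //.
  under eq_integral do rewrite gee0_abs//.
  apply: le_lt_trans (fatou mu measurableT mf (fun n y _ => f0 n y)) _.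
  apply: (@le_lt_trans _ _ (few_zeros_cost j 0)%:R%:E); last exact: ltry.
  rewrite limn_einf_lim; apply: lime_le; first exact: is_cvg_einfs.
  apply: nearW => n; apply: le_trans (integral_few_zeros_bound n j 0).
  by apply: ereal_inf_lbound; exists n => /=.
have := integrable_ae measurableT intg; apply: filterS => y /(_ I) gfin.
apply: (@finite_set_prefixes _ (Num.trunc (fine (g y))).+1) => n.
rewrite -(ler_nat R); apply: le_trans (ltW (truncnS_gt _)).
rewrite -lee_fin fineK//; apply: le_trans (einf_g y n).
apply: le_ereal_inf_tmp => _ [m /= nm <-].
apply: le_trans (prefixes_few_zeros _ _ _ _).
by rewrite lee_fin ler_nat prefixes_nondecreasing.
Qed.

Lemma ae_finite_takagi_level_set :
  {ae mu, forall y, finite_set (@takagi_level_set R y)}.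
Proof.
(* The bound [k] on the number of zeros depends on [y], so finiteness is needed for all budgets at
   once, outside a single null set. *)
have := ae_foralln (fun j => ae_finite_few_zeros_level j).
have := ae_few_zeros.
apply: (@filterS2 _ _ (ae_filter_ringOfSetsType mu)) => y [k Hk] fin.
apply: sub_finite_set (fin k) => b; rewrite -tilted_level0 => yb.
by split => // n; exact: Hk.
Qed.

End zeros_of_deficiency.

Theorem theorem1p2 (R : realType) :
  {ae @lebesgue_measure R, forall y : R,
     0 <= y <= 2 / 3 -> finite_set (takagi_level_set y)}
  /\
  [/\ measurable_fun [set: R] (@takagi_level_card R),
      (\int[uniform_prob (@lt0_23 R)]_y @takagi_level_card R y = +oo)%E &
      ((3 / 2)%:E * \int[@lebesgue_measure R]_(y in `[0%R, (2 / 3)%R])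
          @takagi_level_card R y = +oo)%E].
Proof.
split.
  apply: (@filterS _ _ (ae_filter_ringOfSetsType _))
    (@ae_finite_takagi_level_set R) => y fin _; exact: fin.
split.
- exact: measurable_takagi_level_card.
- rewrite integral_uniform//; last exact: takagi_level_card_ge0.
    by rewrite integral_takagi_level_card gt0_muley// lte_fin invr_gt0; lra.
  exact: measurable_takagi_level_card.
- by rewrite integral_takagi_level_card gt0_muley// lte_fin; lra.
Qed.
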